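(* Let $\mathcal H$ be a real Hilbert space, $K\subset\mathcal H$ a nonempty closed convex set, $q\ge 1$ an integer, and let $f_i:\mathcal H\to\mathbb R$ ($i=1,\dots,q$) be convex continuous functions that are Lipschitz continuous on bounded sets and bounded from below on $\mathcal H$. Let $u\in K$ be a point which is not Pareto critical, i.e. $u\in K\setminus\mathcal P_c$. Then the multiobjective steepest descent direction $s(u)$ can be formulated in the following equivalent forms: 1. $s(u)=\Big(-N_K(u)-\mathrm{Conv}\{\partial f_i(u)\}\Big)^0$; 2. for all $r\in\,]1,+\infty[$, $$\frac{s(u)}{\|s(u)\|^{\frac{r-2}{r-1}}}=\underset{d\in T_K(u)}{\mathrm{argmin}}\left\{\frac1r\|d\|^r+\max_{i=1,\dots,q}df_i(u,d)\right\};$$ 3. $$\frac{s(u)}{\|s(u)\|}=\underset{d\in T_K(u),\ \|d\|=1}{\mathrm{argmin}}\ \left\{\max_{i=1,\dots,q}df_i(u,d)\right\}.$$ (In 2 and 3 the equality means that the left-hand side is the unique minimizer.)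
   Context: For $u\in K$: $N_K(u)=\{\eta\in\mathcal H:\langle\eta,v-u\rangle\le 0\ \forall v\in K\}$ is the normal cone to $K$ at $u$, and $T_K(u)=\{v\in\mathcal H:\langle v,\eta\rangle\le 0\ \forall\eta\in N_K(u)\}$ is the tangent cone. $\partial f_i$ denotes the convex subdifferential, and $df_i(u,d)=\lim_{t\downarrow 0}\frac{f_i(u+td)-f_i(u)}{t}$ the directional derivative. $\mathcal S^q=\{\theta\in\mathbb R^q:0\le\theta_i\le1,\ \sum_{i=1}^q\theta_i=1\}$ is the unit simplex, and $\mathrm{Conv}\{\partial f_i(u)\}=\{\sum_{i=1}^q\theta_ip_i:\ p_i\in\partial f_i(u),\ (\theta_i)\in\mathcal S^q\}$. For a nonempty closed convex set $C\subset\mathcal H$, $C^0$ denotes its unique element of minimal norm. The multiobjective steepest descent direction at $u\in K$ is defined as $s(u):=\big(-N_K(u)-\mathrm{Conv}\{\partial f_i(u)\}\big)^0$ (so item 1 is the definition of $s(u)$). A point $u\in K$ is Pareto critical if there exists $(\theta_i)\in\mathcal S^q$ with $0\in N_K(u)+\sum_{i=1}^q\theta_i\partial f_i(u)$; $\mathcal P_c$ is the set of Pareto critical points. *)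

(* Defs.v *)
From HB Require Import structures.
From mathcomp Require Import all_boot all_order all_algebra.
From mathcomp Require Import all_classical all_reals all_analysis.

Set Implicit Arguments.
Unset Strict Implicit.
Unset Printing Implicit Defensive.

Import Order.TTheory GRing.Theory Num.Theory.
Import numFieldNormedType.Exports.

Local Open Scope classical_set_scope.
Local Open Scope ring_scope.

(* The real Hilbert space is a complete normed module H whose norm is induced
   by a (symmetric, bilinear, positive definite) form dot : {dot H for idfun},
   i.e. `|x| ^+ 2 = dot x x. *)

Section defs.
Context {R : realType} {H : completeNormedModType R}.
Implicit Types (dot : {dot H for idfun}) (K A C : set H) (u d : H).

Definition normal_cone dot K u : set H :=
  [set eta | forall v, K v -> dot eta (v - u) <= 0].

Definition tangent_cone dot K u : set H :=
  [set v | forall eta, normal_cone dot K u eta -> dot v eta <= 0].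

Definition subdifferential dot (f : H -> R) u : set H :=
  [set p | forall v, f u + dot p (v - u) <= f v].

Definition directional_derivative (f : H -> R) u d : R :=
  lim ((f (u + t *: d) - f u) / t @[t --> 0^'+]).

Definition simplex (q : nat) : set ('I_q -> R) :=
  [set theta | (forall i, 0 <= theta i <= 1) /\ \sum_(i < q) theta i = 1].

Definition conv_subdifferentials dot (q : nat) (f : 'I_q -> H -> R) u : set H :=
  [set x | exists theta p, [/\ simplex theta,
     forall i, subdifferential dot (f i) u (p i) &
     x = \sum_(i < q) theta i *: p i]].

(* - N_K(u) - Conv {subdifferentials of the f_i at u}, as a Minkowski sum *)
Definition descent_set dot K (q : nat) (f : 'I_q -> H -> R) u : set H :=
  [set - eta - p | eta in normal_cone dot K u
                 & p in conv_subdifferentials dot f u].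

Definition pareto_critical dot K (q : nat) (f : 'I_q -> H -> R) : set H :=
  [set u | K u /\ exists2 theta, simplex theta &
     exists eta p, [/\ normal_cone dot K u eta,
       forall i, subdifferential dot (f i) u (p i) &
       0 = eta + \sum_(i < q) theta i *: p i]].

Definition argmin A (F : H -> R) : set H :=
  [set x | A x /\ forall y, A y -> F x <= F y].

(* Only meaningful when C has a unique element of minimal norm, e.g. when C is
   nonempty, closed and convex; the value is arbitrary otherwise. *)
Definition min_norm_elt C : H := xget 0 (argmin C (fun x => `|x|)).

Definition steepest_descent dot K (q : nat) (f : 'I_q -> H -> R) u : H :=
  min_norm_elt (descent_set dot K f u).

(* The maximum of the finite nonempty family F; its starting value is one of
   the members of the family, so it does not affect the result. *)
Definition fin_max (q : nat) (hq : (0 < q)%N) (F : 'I_q -> R) : R :=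
  \big[Num.max/F (Ordinal hq)]_(i < q) F i.

End defs.

(* Main.v *)
(* The descent set D = - N_K(u) - Conv{df_i(u)} is convex.  It is sequentially
   closed: bounded sequences of subgradients have weak limits along an
   ultrafilter on nat (the limit functional is represented by Riesz' theorem),
   and normal vectors and subgradients are stable under weak limits.  So D has
   an element s of minimal norm, characterized by |s|^2 <= <s, x> for x in D.

   Applied to x = - a eta - p, with eta normal and a large, this gives s in
   T_K(u) and <s, p> <= - |s|^2 for all subgradients p, hence
   max_i df_i(u, s) <= - |s|^2.  Writing s = - eta - sum_i theta_i p_i gives
   max_i df_i(u, d) >= - <s, d> for all d in T_K(u).  Items 2 and 3 then
   reduce to the equality cases of Cauchy-Schwarz and of the strict tangent
   inequality for t^r. *)

Require Import Defs.
From HB Require Import structures.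
From mathcomp Require Import all_boot all_order all_algebra.
From mathcomp Require Import all_classical all_reals all_analysis.
From mathcomp Require Import ring lra.

Set Implicit Arguments.
Unset Strict Implicit.
Unset Printing Implicit Defensive.

Import Order.TTheory GRing.Theory Num.Theory.
Import numFieldNormedType.Exports.

Local Open Scope classical_set_scope.
Local Open Scope ring_scope.

(** * Riesz representation *)

Section hilbert.
Context {R : realType} {H : completeNormedModType R} (dot : {dot H for idfun}).
Context (norm_dot : forall x : H, `|x| ^+ 2 = dot x x).
Implicit Types (x y h : H) (A : set H).

Lemma dotC x y : dot x y = dot y x.
Proof. by rewrite hermC expr0 mul1r. Qed.

Lemma dotDr x y h : dot h (x + y) = dot h x + dot h y.
Proof. exact: linearDr. Qed.

Lemma dotNr x h : dot h (- x) = - dot h x.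
Proof. exact: linearNr. Qed.

Lemma dotZr a x h : dot h (a *: x) = a * dot h x.
Proof. exact: linearZr_LR. Qed.

Lemma dotDl x y h : dot (x + y) h = dot x h + dot y h.
Proof. by rewrite dotC dotDr !(dotC h). Qed.

Lemma dotNl x h : dot (- x) h = - dot x h.
Proof. by rewrite dotC dotNr (dotC h). Qed.

Lemma dotZl a x h : dot (a *: x) h = a * dot x h.
Proof. by rewrite dotC dotZr (dotC h). Qed.

Lemma dot0r h : dot h 0 = 0.
Proof. exact: linear0r. Qed.

Lemma dot_lincombl (n : nat) (a : 'I_n -> R) (x : 'I_n -> H) h :
  dot (\sum_i a i *: x i) h = \sum_i a i * dot (x i) h.
Proof.
rewrite dotC linear_sumr; apply: eq_bigr => i _.
by rewrite -[LHS]/(dot h (a i *: x i)) dotZr dotC.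
Qed.

Definition dotE := (dotDr, dotNr, dotZr, dotDl, dotNl, dotZl).

Lemma normD2 x y : `|x + y| ^+ 2 = `|x| ^+ 2 + 2 * dot x y + `|y| ^+ 2.
Proof. by rewrite !norm_dot !dotE (dotC y x); ring. Qed.

Lemma normB2 x y : `|x - y| ^+ 2 = `|x| ^+ 2 - 2 * dot x y + `|y| ^+ 2.
Proof. by rewrite normD2 dotNr normrN; ring. Qed.

(** The triangle inequality comes with the norm; squaring it gives the bound. *)
Lemma cauchy_schwarz x y : dot x y <= `|x| * `|y|.
Proof.
have : `|x + y| ^+ 2 <= (`|x| + `|y|) ^+ 2.
  by rewrite lerXn2r ?nnegrE ?addr_ge0 // ler_normD.
by rewrite normD2; nra.
Qed.

Lemma norm_dot_le x y : `|dot x y| <= `|x| * `|y|.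
Proof.
rewrite ler_norml cauchy_schwarz andbT lerNl -dotNr.
by rewrite (le_trans (cauchy_schwarz _ _)) ?normrN.
Qed.

Lemma dot_cvg (T : Type) (F : set_system T) {FF : Filter F}
    (x : T -> H) (l h : H) :
  x t @[t --> F] --> l -> dot (x t) h @[t --> F] --> dot l h.
Proof.
move=> xl; apply/cvgrPdist_le => e e0.
have eh : 0 < e / (`|h| + 1) by rewrite divr_gt0 // ltr_wpDl.
move/cvgrPdist_le: xl => /(_ _ eh); apply: filterS => t lxt; rewrite -dotNl -dotDl.
rewrite (le_trans (norm_dot_le _ _)) //.
have h1 : 0 < `|h| + 1 by rewrite ltr_wpDl.
have : `|l - x t| * (`|h| + 1) <= e by rewrite -ler_pdivlMr.
by have := normr_ge0 (l - x t); nra.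
Qed.

Definition midpoint_set A := forall x y, A x -> A y -> A (2^-1 *: (x + y)).

(** By the parallelogram identity, minimizing sequences of [|x|^2 + G x] are Cauchy. Used for Riesz
    representation and sublinear supports through [minimizer_exists], and with [G = 0] for elements
    of minimal norm; each use shows that the limit is a minimizer. *)
Lemma minimizing_sequence_cvg A (G : H -> R) :
    A !=set0 -> midpoint_set A ->
    (forall x y, A x -> A y -> G (2^-1 *: (x + y)) <= (G x + G y) / 2) ->
    (exists m, forall x, A x -> m <= `|x| ^+ 2 + G x) ->
  exists x : nat -> H, [/\ forall n, A (x n),
    forall y n, A y -> `|x n| ^+ 2 + G (x n) <= `|y| ^+ 2 + G y + n.+1%:R^-1 &
    cvg (x n @[n --> \oo])].
Proof.
move=> [a Aa] Amid Gmid [m mF]; pose F x : R := `|x| ^+ 2 + G x.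
have Finf : has_inf (F @` A).
  by split; [exists (F a), a | exists m => _ [x Ax <-]; exact: mF].
have infF y : A y -> inf (F @` A) <= F y.
  by move=> Ay; apply: ge_inf; [exact: Finf.2 | exists y].
have /choice[x xP] (n : nat) :
    exists x, A x /\ F x < inf (F @` A) + n.+1%:R^-1.
  have [|_ [x Ax <-] ?] := @inf_adherent _ (F @` A) n.+1%:R^-1 _ Finf.
    by rewrite invr_gt0.
  by exists x.
have quarter y z : A y -> A z ->
    `|y - z| ^+ 2 / 4 <= (F y + F z) / 2 - inf (F @` A).
  move=> Ay Az; have := infF _ (Amid _ _ Ay Az); have := Gmid _ _ Ay Az.
  have half2 : 2^-1 ^+ 2 = 4^-1 :> R by field.
  rewrite /F normrZ exprMn normB2 normD2 ger0_norm ?invr_ge0 // half2; lra.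
exists x; split=> [n|y n Ay|]; first exact: (xP n).1.
  by rewrite (le_trans (ltW (xP n).2)) // lerD2r infF.
apply/cauchy_cvgP/cauchy_exP => e e0.
(* From index [N] on, the excess over the infimum is below [e ^+ 2 / 4], so [quarter] puts the
   distance to [x N] below [e]. *)
have e2 : 0 < e ^+ 2 / 4 by rewrite divr_gt0 ?exprn_gt0.
have [N _ NP] := near_infty_natSinv_lt (PosNum e2).
exists (x N); exists N => // n /= Nn; rewrite -ball_normE /=.
rewrite -(@ltr_pXn2r _ 2) ?nnegrE ?normr_ge0 ?(ltW e0) //.
have := quarter _ _ (xP N).1 (xP n).1; have := (xP N).2; have := (xP n).2.
have := NP N (leqnn N); have := NP n Nn => /=.
by move: N.+1%:R^-1 n.+1%:R^-1 (inf _) => a1 a2 i; lra.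
Qed.

Lemma minimizer_exists (G : H -> R) (c : R) :
    (forall x y, `|G x - G y| <= c * `|x - y|) ->
    (forall x y, G (2^-1 *: (x + y)) <= (G x + G y) / 2) ->
  exists p, forall y, `|p| ^+ 2 + G p <= `|y| ^+ 2 + G y.
Proof.
move=> Glip Gmid.
have Gcont : continuous G.
  move=> x; apply/cvgrPdist_le => e e0; near=> y.
  rewrite (le_trans (Glip _ _)) //.
  have c1 : 0 < `|c| + 1 by rewrite ltr_wpDl.
  have : `|x - y| <= e / (`|c| + 1).
    near: y; apply: cvgr_dist_le; first exact: cvg_id.
    by rewrite divr_gt0.
  rewrite ler_pdivlMr // => ?; have := ler_norm c; have := normr_ge0 (x - y).
  nra.
have [||||x [_ xmin xcvg]] := @minimizing_sequence_cvg setT G.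
- by exists 0.
- by [].
- by move=> x y _ _; exact: Gmid.
(* The Lipschitz bound gives [G x >= G 0 - c * |x|]; completing the square bounds [|x|^2 - c * |x|]
   from below. *)
- exists (G 0 - c ^+ 2) => x _.
  have := Glip x 0; have := ler_norm (G 0 - G x); rewrite subr0 distrC.
  by have := sqr_ge0 (`|x| - c / 2); have := sqr_ge0 c; nra.
exists (lim (x n @[n --> \oo])) => y.
set p := lim _.
have Fp : `|x n| ^+ 2 + G (x n) @[n --> \oo] --> `|p| ^+ 2 + G p.
  apply: cvgD; last exact: (cvg_comp _ _ xcvg (Gcont p)).
  by rewrite !expr2; apply: cvgM; exact: cvg_norm.
have Fy : `|y| ^+ 2 + G y + n.+1%:R^-1 @[n --> \oo] --> `|y| ^+ 2 + G y + 0.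
  by apply: cvgD; [exact: cvg_cst | exact: cvg_harmonic].
rewrite -[leRHS]addr0; apply: ler_cvg_to Fp Fy _.
by apply: nearW => n; exact: xmin.
Unshelve. all: by end_near. Qed.

(** First-order optimality condition in one variable. The range [t <= 1] suits variations along a
    segment of a convex set. *)
Lemma quadratic_ge0_coef (a b : R) :
  (forall t, 0 < t <= 1 -> 0 <= t * a + t ^+ 2 * b) -> 0 <= a.
Proof.
move=> ab; rewrite leNgt; apply/negP => a0.
(* At [t / 2] the quadratic term offsets at most half of the negative linear term. *)
pose t := - a / (`|b| + `|a|).
have t0 : 0 < `|b| + `|a| by rewrite ltr_wpDl // normr_gt0 lt_eqF.
have tE : t * (`|b| + `|a|) = - a by rewrite /t divfK // gt_eqF.
have tgt0 : 0 < t by rewrite divr_gt0 // oppr_gt0.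
have bb := ler_norm b; have b0 := normr_ge0 b.
have aa : `|a| = - a by rewrite ltr0_norm.
have t1 : t <= 1 by rewrite ler_pdivrMr // mul1r -aa lerDr.
have t2 : 0 < t / 2 <= 1 by lra.
have := ab _ t2; rewrite leNgt => /negP; apply.
have -> : t / 2 * a + (t / 2) ^+ 2 * b = (t / 2) * (a + (t / 2) * b) by ring.
rewrite pmulr_rlt0; nra.
Qed.

(** The representative is the minimizer of [|x|^2 - 2 L x]; first-order conditions along [h] and
    [- h] give the two inequalities. *)
Lemma riesz (L : H -> R) (c : R) :
    (forall a x y, L (a *: x + y) = a * L x + L y) ->
    (forall x, `|L x| <= c * `|x|) ->
  exists p, forall h, L h = dot p h.
Proof.
move=> Llin Lbnd.
have L0 : L 0 = 0 by have := Llin 1 0 0; rewrite scale1r addr0; lra.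
have LZ a x : L (a *: x) = a * L x by have := Llin a x 0; rewrite !addr0 L0 addr0.
have LD x y : L (x + y) = L x + L y by have := Llin 1 x y; rewrite scale1r mul1r.
have LN x : L (- x) = - L x by rewrite -scaleN1r LZ mulN1r.
have [||p pmin] := @minimizer_exists (fun x => - 2 * L x) (2 * c).
- move=> x y; have -> : - 2 * L x - - 2 * L y = - 2 * L (x - y) by rewrite LD LN; ring.
  by rewrite normrM normrN (@ger0_norm _ 2) // -mulrA ler_pM2l.
- by move=> x y; rewrite LZ LD; lra.
exists p => h; apply/eqP; rewrite eq_le; apply/andP.
have base t : 0 <= t * (2 * (dot p h - L h)) + t ^+ 2 * `|h| ^+ 2.
  have := pmin (p + t *: h).
  rewrite normD2 LD LZ dotZr normrZ exprMn -normrX ger0_norm ?sqr_ge0 //; lra.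
split.
- suff : 0 <= 2 * (dot p h - L h) by lra.
  by apply: (@quadratic_ge0_coef _ (`|h| ^+ 2)) => t _; exact: base.
- suff : 0 <= - (2 * (dot p h - L h)) by lra.
  apply: (@quadratic_ge0_coef _ (`|h| ^+ 2)) => t _.
  by have := base (- t); rewrite sqrrN mulrN mulNr.
Qed.

End hilbert.

(** * Weak limits and projection *)

(** The image ultrafilter clusters in the compact segment [[- c, c]], and a cluster point of an
    ultrafilter is a limit, since every set or its complement belongs to it. *)
Lemma ultra_bounded_cvg {R : realType} (U : set_system nat) {UU : UltraFilter U}
    (a : nat -> R) (c : R) :
  (forall n, `|a n| <= c) -> cvg (a n @[n --> U]).
Proof.
move=> ac.
have [|p [_ cp]] := @segment_compact R (- c) c (a @ U) _.
  by apply: (@filterE _ U) => n /=; rewrite in_itv /= -ler_norml.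
apply/cvg_ex; exists p => B pB.
have [//|UnB] := in_ultra_setVsetC (a @^-1` B) UU.
by have [z [nBz Bz]] := cp (~` B) B UnB pB.
Qed.

Section weak_compactness.
Context {R : realType} {H : completeNormedModType R} (dot : {dot H for idfun}).
Context (norm_dot : forall x : H, `|x| ^+ 2 = dot x x).
Context (U : set_system nat) {UU : UltraFilter U}.

(** One ultrafilter makes all pairings converge at once, which replaces a diagonal extraction; the
    limits form a bounded linear functional. *)
Lemma ultra_bounded_weak_cvg (x : nat -> H) (c : R) :
    (forall n, `|x n| <= c) ->
  exists p, forall h, dot (x n) h @[n --> U] --> dot p h.
Proof.
move=> xc; pose L h := lim (dot (x n) h @[n --> U]).
have bnd h n : `|dot (x n) h| <= c * `|h|.
  by rewrite (le_trans (norm_dot_le norm_dot _ _)) // ler_wpM2r.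
have Lcvg h : dot (x n) h @[n --> U] --> L h.
  exact: ultra_bounded_cvg (bnd h).
have [|h|p Lp] := @riesz _ _ dot norm_dot L c.
- move=> a y z; apply/esym; apply: (@cvg_unique _ _ _ _ _ _ _ (Lcvg _)) => //.
rewrite /=.
  under eq_fun do rewrite dotDr dotZr.
  by apply: cvgD (Lcvg z); apply: cvgM (Lcvg y); exact: cvg_cst.
- apply: (ler_cvg_to (cvg_norm (Lcvg h)) (cvg_cst (c * `|h|))).
  exact: nearW (bnd h).
by exists p => h; rewrite -Lp.
Qed.

End weak_compactness.

(** * Elements of minimal norm in convex sets *)

Section projection.
Context {R : realType} {H : completeNormedModType R} (dot : {dot H for idfun}).
Context (norm_dot : forall x : H, `|x| ^+ 2 = dot x x).
Implicit Types (A : set H) (s x : H).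

Definition segment_closed A :=
  forall x y t, A x -> A y -> 0 <= t <= 1 -> A (t *: x + (1 - t) *: y).

(** Variational inequality for the projection of the origin: [s] is compared with [s + t (x - s)]
    for small [t]. *)
Lemma argmin_norm_dot A s x : segment_closed A ->
  argmin A (fun x => `|x|) s -> A x -> `|s| ^+ 2 <= dot s x.
Proof.
move=> Aconv [As smin] Ax; rewrite -subr_ge0.
suff : 0 <= 2 * (dot s x - `|s| ^+ 2) by lra.
apply: (@quadratic_ge0_coef _ _ (`|x - s| ^+ 2)) => t t01.
have := smin _ (Aconv x s t Ax As ltac:(lra)).
rewrite -(@ler_pXn2r _ 2) ?nnegrE //.
have -> : t *: x + (1 - t) *: s = s + t *: (x - s).
  by rewrite scalerBl scale1r scalerBr addrCA.
rewrite (normD2 norm_dot s) dotZr dotDr dotNr -norm_dot normrZ exprMn real_normK ?num_real //.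
lra.
Qed.

(** The sum of the variational inequalities at [s] and [s'] is [|s - s'|^2 <= 0]. *)
Lemma argmin_norm_uniq A s s' : segment_closed A ->
  argmin A (fun x => `|x|) s -> argmin A (fun x => `|x|) s' -> s = s'.
Proof.
move=> Aconv smin s'min; apply/eqP; rewrite -subr_eq0 -normr_eq0 -sqrf_eq0.
rewrite eq_le sqr_ge0 andbT (normB2 norm_dot).
have := argmin_norm_dot Aconv smin s'min.1.
have := argmin_norm_dot Aconv s'min smin.1.
by rewrite (dotC dot s' s); lra.
Qed.

Lemma argmin_norm_exists A : A !=set0 -> segment_closed A ->
    (forall (x : nat -> H) l,
      (forall n, A (x n)) -> x n @[n --> \oo] --> l -> A l) ->
  exists s, argmin A (fun x => `|x|) s.
Proof.
move=> A0 Aconv Acl.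
have [||||x [Ax xmin xcvg]] := @minimizing_sequence_cvg _ _ dot norm_dot A (fun=> 0).
- by [].
- move=> x y Ax Ay; have := Aconv x y 2^-1 Ax Ay ltac:(lra).
  have -> : 1 - 2^-1 = 2^-1 :> R by lra.
  by rewrite scalerDr.
- by move=> x y _ _; lra.
- by exists 0 => x _; rewrite addr0 sqr_ge0.
exists (lim (x n @[n --> \oo])); split=> [|y Ay]; first exact: Acl xcvg.
rewrite -(@ler_pXn2r _ 2) ?nnegrE //.
set l := lim _.
have xl : `|x n| ^+ 2 @[n --> \oo] --> `|l| ^+ 2.
  by rewrite !expr2; apply: cvgM; exact: cvg_norm.
have yl : `|y| ^+ 2 + n.+1%:R^-1 @[n --> \oo] --> `|y| ^+ 2 + 0.
  by apply: cvgD; [exact: cvg_cst | exact: cvg_harmonic].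
rewrite -[leRHS]addr0; apply: ler_cvg_to xl yl _.
by apply: nearW => n; have := xmin y n Ay; rewrite !addr0.
Qed.

End projection.

(** * Directional derivatives and subgradients *)

Section sublinear.
Context {R : realType} {H : completeNormedModType R} (dot : {dot H for idfun}).
Context (norm_dot : forall x : H, `|x| ^+ 2 = dot x x).

(* The minimizer x of |x - d|^2 / (2 l) + g x gives the support functional
   (d - x) / l of g, which is exact at x and hence nearly exact at d. *)
Lemma sublinear_approx_support (g : H -> R) (c : R) :
    (forall x y, g (x + y) <= g x + g y) ->
    (forall a x, 0 < a -> g (a *: x) = a * g x) ->
    0 <= c -> (forall x, g x <= c * `|x|) ->
  forall d e, 0 < e ->
  exists p, (forall h, dot p h <= g h) /\ g d - e <= dot p d.
Proof.
move=> gD gZ c0 gc d e e0.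
have glip x y : `|g x - g y| <= c * `|x - y|.
  rewrite ler_norml; apply/andP; split.
    have := gD x (y - x); rewrite [x + _]addrC subrK.
    by have := gc (y - x); rewrite distrC; lra.
  have := gD y (x - y); rewrite [y + _]addrC subrK.
  by have := gc (x - y); lra.
have g0 : g 0 = 0.
  by have := gZ 2 0 ltac:(lra); rewrite scaler0; lra.
have c2 : 0 < c ^+ 2 + 1 by rewrite ltr_wpDl // sqr_ge0.
(* The final loss at [d] is at most [l * c ^+ 2], which this choice keeps below [e]. *)
have [l l0 lE] : exists2 l, 0 < l & l * (c ^+ 2 + 1) = e.
  by exists (e / (c ^+ 2 + 1)); rewrite ?divr_gt0 // divfK // gt_eqF.
(* [|x|^2 + G x] is [2 l] times the functional to be minimized, up to the constant [|d|^2]. *)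
pose G x := - 2 * dot d x + 2 * l * g x.
have [x y|x y|x xmin] := @minimizer_exists _ _ dot norm_dot G (2 * `|d| + 2 * l * c).
- have -> : G x - G y = - 2 * dot d (x - y) + 2 * l * (g x - g y).
    by rewrite /G dotDr dotNr; ring.
  rewrite (le_trans (ler_normD _ _)) // [leRHS]mulrDl !normrM normrN.
  rewrite (@ger0_norm _ 2) // (@ger0_norm _ l) ?(ltW l0) //.
  have := norm_dot_le norm_dot d (x - y); have := glip x y => ? ?.
  by rewrite lerD // -!mulrA ler_pM2l // ler_pM2l.
- rewrite /G dotZr dotDr gZ ?invr_gt0 //.
  by have := gD x y; nra.
have support h : dot (d - x) h <= l * g h.
  suff : 0 <= 2 * (l * g h - dot (d - x) h) by lra.
  apply: (@quadratic_ge0_coef _ _ (`|h| ^+ 2)) => t /andP[t0 _].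
  have := xmin (x + t *: h); rewrite (normD2 norm_dot x) normrZ.
  rewrite exprMn real_normK ?num_real //.
  rewrite /G !dotE.
  have := gD x (t *: h); rewrite gZ //; nra.
(* The variation [(1 - t) x] stays on the ray of [x], where [g] is homogeneous; this reverses
   [support x]. *)
have exact_x : l * g x <= dot (d - x) x.
  suff : 0 <= 2 * (dot (d - x) x - l * g x) by lra.
  apply: (@quadratic_ge0_coef _ _ (`|x| ^+ 2)) => t /andP[t0 t1].
  have := xmin (x + - t *: x); rewrite (normD2 norm_dot x) normrZ.
  rewrite exprMn real_normK ?num_real //.
  rewrite /G !dotE.
  have -> : g (x + - t *: x) = (1 - t) * g x.
    rewrite -{1}[x]scale1r -scalerDl.
    have [t1'|t1'] := ltP t 1; first by rewrite gZ // subr_gt0.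
    by have -> : t = 1 by [lra]; rewrite subrr scale0r mul0r g0.
  by rewrite sqrrN norm_dot; nra.
have dx : `|d - x| <= l * c.
  have [->|dx0] := eqVneq `|d - x| 0; first by rewrite mulr_ge0 // ltW.
  have := support (d - x); have := gc (d - x); rewrite -norm_dot => ? ?.
  have : 0 < `|d - x| by rewrite lt_neqAle eq_sym dx0 normr_ge0.
  by nra.
exists (l^-1 *: (d - x)); split=> [h|].
  by rewrite dotZl mulrC ler_pdivrMr // mulrC.
have dE : dot (d - x) d = dot (d - x) x + `|d - x| ^+ 2.
  by rewrite norm_dot -dotDr [x + _]addrC subrK.
rewrite dotZl mulrC ler_pdivlMr // dE.
have := gD x (d - x); rewrite [x + _]addrC subrK => gd.
have := gc (d - x); have := sqr_ge0 `|d - x|.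
have : c * `|d - x| <= c * (l * c) by rewrite ler_wpM2l.
have : 0 <= c ^+ 2 by rewrite sqr_ge0.
nra.
Qed.

End sublinear.

(** * Directional derivatives of a convex function *)

Section directional_derivative.
Context {R : realType} {H : completeNormedModType R} (dot : {dot H for idfun}).
Context (norm_dot : forall x : H, `|x| ^+ 2 = dot x x).
Context (f : H -> R) (f_convex : convex_function [set: H] f) (u : H).
Context (c : R) (c_ge0 : 0 <= c).
Context (f_lip : forall x, `|x - u| <= 1 -> `|f x - f u| <= c * `|x - u|).

Local Notation df := (directional_derivative f u).
Let quot d (t : R) : R := (f (u + t *: d) - f u) / t.

Lemma convex_le x y (t : R) : 0 <= t <= 1 ->
  f (t *: x + (1 - t) *: y) <= t * f x + (1 - t) * f y.
Proof.
by move=> /andP[t0 t1]; have := f_convex (Itv01 t0 t1) (in_setT x) (in_setT y).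
Qed.

(** [u + s d] divides the segment from [u] to [u + t d] with weight [s / t]. *)
Lemma quot_le d s t : 0 < s -> s <= t -> quot d s <= quot d t.
Proof.
move=> s0 st; have t0 : 0 < t by lra.
have st01 : 0 <= s / t <= 1 by rewrite divr_ge0 ?(ltW s0) ?(ltW t0) //= ler_pdivrMr // mul1r.
have := convex_le (u + t *: d) u st01.
have -> : s / t *: (u + t *: d) + (1 - s / t) *: u = u + s *: d.
  rewrite scalerDr addrAC -scalerDl addrC scalerA divfK ?gt_eqF //.
  by rewrite addrC [s / t + _]addrC subrK scale1r.
rewrite /quot ler_pdivrMr // => fle.
have -> : (f (u + t *: d) - f u) / t * s = s / t * (f (u + t *: d) - f u) by ring.
lra.
Qed.

(** [u] is a convex combination of [u + t d] and [u - d], with weights [1 / (1 + t)] and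
    [t / (1 + t)]. The bound keeps the infimum of the quotients finite. *)
Lemma quot_ge d t : 0 < t -> f u - f (u - d) <= quot d t.
Proof.
move=> t0; have t1 : 0 < 1 + t by lra.
have t01 : 0 <= (1 + t)^-1 <= 1 by rewrite invr_ge0 (ltW t1) /= invf_le1 //; lra.
have := convex_le (u + t *: d) (u - d) t01.
have tE : 1 - (1 + t)^-1 = (1 + t)^-1 * t by field; rewrite gt_eqF.
rewrite tE -scalerA -scalerDr.
have -> : u + t *: d + t *: (u - d) = (1 + t) *: u.
  by rewrite scalerBr addrA addrAC addrK scalerDl scale1r.
rewrite scalerA mulVf ?gt_eqF // scale1r -mulrA -mulrDr mulrC ler_pdivlMr //.
by rewrite /quot ler_pdivlMr //; lra.
Qed.

(** Monotone and bounded below, the quotients converge, so the [lim] in [directional_derivative] is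
    a genuine limit. *)
Lemma quot_cvg d :
  quot d t @[t --> 0^'+] --> inf [set quot d t | t in [set t | 0 < t]].
Proof.
have -> : [set t : R | 0 < t] = [set` Interval (BRight 0) (BInfty R false)].
  by apply/seteqP; split=> t /=; rewrite in_itv /= andbT.
apply: nondecreasing_at_right_cvgr => //.
- by move=> s t; rewrite !in_itv /= !andbT => s0 t0; exact: quot_le.
- exists (f u - f (u - d)) => y [t /=]; rewrite in_itv /= andbT => t0 <-.
  exact: quot_ge.
Qed.

Lemma directional_derivativeE d :
  df d = inf [set quot d t | t in [set t | 0 < t]].
Proof. by apply/cvg_lim; [exact: Rhausdorff|exact: quot_cvg]. Qed.

Lemma directional_derivative_le d t : 0 < t -> df d <= quot d t.
Proof.
move=> t0; rewrite directional_derivativeE; apply: ge_inf; last by exists t.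
by exists (f u - f (u - d)) => _ [s s0 <-]; exact: quot_ge.
Qed.

Lemma directional_derivative_ge d a :
  (forall t, 0 < t -> a <= quot d t) -> a <= df d.
Proof.
move=> aq; rewrite directional_derivativeE; apply: lb_le_inf.
  by exists (quot d 1), 1 => //=.
by move=> _ [t t0 <-]; exact: aq.
Qed.

Lemma directional_derivativeZ a d : 0 < a -> df (a *: d) = a * df d.
Proof.
move=> a0.
have quotZ t : 0 < t -> quot (a *: d) t = a * quot d (a * t).
  move=> t0; rewrite /quot scalerA (mulrC t a); field.
  by rewrite !gt_eqF.
apply/eqP; rewrite eq_le; apply/andP; split.
  rewrite mulrC -ler_pdivrMr //; apply: directional_derivative_ge => t t0.
  have at0 : 0 < a^-1 * t by rewrite mulr_gt0 ?invr_gt0.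
  rewrite ler_pdivrMr // mulrC (le_trans (directional_derivative_le _ at0)) //.
  by rewrite quotZ // [a * (a^-1 * t)]mulrA mulfV ?gt_eqF // mul1r.
apply: directional_derivative_ge => t t0.
rewrite quotZ // ler_pM2l //; apply: directional_derivative_le.
by rewrite mulr_gt0.
Qed.

Lemma directional_derivativeD x y : df (x + y) <= df x + df y.
Proof.
rewrite -lerBlDr; apply: directional_derivative_ge => s s0.
rewrite lerBlDl -lerBlDr; apply: directional_derivative_ge => t t0.
rewrite lerBlDr.
(* Monotonicity reduces both quotients to the common step [r]; convexity at the midpoint of
   [u + r x] and [u + r y] then concludes. *)
pose r := Num.min s t.
have r0 : 0 < r by rewrite lt_min s0.
have rs : r <= s by rewrite ge_min lexx.
have rt : r <= t by rewrite ge_min lexx orbT.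
have := quot_le x r0 rs; have := quot_le y r0 rt.
have r2 : 0 < r / 2 by lra.
have := directional_derivative_le (x + y) r2.
suff : quot (x + y) (r / 2) <= quot x r + quot y r by lra.
rewrite {1}/quot ler_pdivrMr //.
have -> : (quot x r + quot y r) * (r / 2) =
    ((f (u + r *: x) - f u) + (f (u + r *: y) - f u)) / 2.
  by rewrite /quot; field; rewrite gt_eqF.
have := @convex_le (u + r *: x) (u + r *: y) 2^-1 ltac:(lra).
have -> : 1 - 2^-1 = 2^-1 :> R by lra.
have -> : 2^-1 *: (u + r *: x) + 2^-1 *: (u + r *: y) = u + (r / 2) *: (x + y).
  rewrite !scalerDr !scalerA (mulrC r) addrACA -scalerDl.
  have -> : 2^-1 + 2^-1 = 1 :> R by lra.
  by rewrite scale1r.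
lra.
Qed.

Lemma directional_derivative_bound d : df d <= c * `|d|.
Proof.
(* This step keeps [t d] in the unit ball, where [f_lip] applies. *)
pose t := (`|d| + 1)^-1.
have d1 : 0 < `|d| + 1 by rewrite ltr_wpDl.
have t0 : 0 < t by rewrite invr_gt0.
rewrite (le_trans (directional_derivative_le d t0)) // ler_pdivrMr //.
have td : `|u + t *: d - u| = t * `|d| by rewrite addrAC subrr add0r normrZ gtr0_norm.
rewrite -mulrA (mulrC `|d|) -td (le_trans (ler_norm _)) // f_lip //.
by rewrite td mulrC ler_pdivrMr // mul1r lerDl.
Qed.

Lemma subdifferential_le_directional p d :
  subdifferential dot f u p -> dot p d <= df d.
Proof.
move=> pf; apply: directional_derivative_ge => t t0.
have := pf (u + t *: d); rewrite ler_pdivlMr // [u + _]addrC addrK dotZr; lra.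
Qed.

Lemma directional_le_subdifferential p :
  (forall d, dot p d <= df d) -> subdifferential dot f u p.
Proof.
move=> pdf v; have := pdf (v - u).
have := directional_derivative_le (v - u) ltr01.
by rewrite /quot scale1r divr1 [u + _]addrC subrK; lra.
Qed.

(** Linear functionals below [df] are subgradients, so the approximate support functional of [df] is
    one. This is the max formula up to [e]. *)
Lemma approx_subgradient d e : 0 < e ->
  exists p, subdifferential dot f u p /\ df d - e <= dot p d.
Proof.
move=> e0.
have [p [pdf pd]] := sublinear_approx_support norm_dot directional_derivativeD
  directional_derivativeZ c_ge0 directional_derivative_bound d e0.
by exists p; split=> //; exact: directional_le_subdifferential.
Qed.

(** Pairing [p] with itself gives [|p|^2 <= df p <= c * |p|]. *)
Lemma subdifferential_norm_le p : subdifferential dot f u p -> `|p| <= c.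
Proof.
move=> pf.
have := subdifferential_le_directional p pf.
have := directional_derivative_bound p; rewrite -norm_dot => ? ?.
have [->//|p0] := eqVneq `|p| 0.
have : 0 < `|p| by rewrite lt_neqAle eq_sym p0 normr_ge0.
by nra.
Qed.

End directional_derivative.

(** * The descent set *)

Section descent_set.
Context {R : realType} {H : completeNormedModType R} (dot : {dot H for idfun}).
Context (norm_dot : forall x : H, `|x| ^+ 2 = dot x x).
Context (K : set H) (q : nat) (f : 'I_q -> H -> R) (u : H).
Local Notation N := (normal_cone dot K u).
Local Notation D := (descent_set dot K f u).

Lemma normal_coneZ a eta : 0 <= a -> N eta -> N (a *: eta).
Proof. by move=> a0 Neta v Kv; rewrite dotZl mulr_ge0_le0 // Neta. Qed.

Lemma normal_coneD eta eta' : N eta -> N eta' -> N (eta + eta').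
Proof.
move=> Neta Neta' v Kv; rewrite dotDl.
by have := Neta v Kv; have := Neta' v Kv; lra.
Qed.

Lemma normal_cone0 : N 0.
Proof. by move=> v Kv; rewrite dotC dot0r. Qed.

(** Merges the terms of the same index in two elements of the convex hull. The unnormalized equation
    also covers [a + b = 0], where any subgradient serves. *)
Lemma subdifferential_mixture (g : H -> R) (a b : R) (p p' : H) :
    subdifferential dot g u p -> subdifferential dot g u p' ->
    0 <= a -> 0 <= b ->
  exists p'', subdifferential dot g u p'' /\ (a + b) *: p'' = a *: p + b *: p'.
Proof.
move=> gp gp' a0 b0; have [ab0|ab0] := eqVneq (a + b) 0.
  exists p; split=> //.
  have -> : a = 0 by lra.
  have -> : b = 0 by lra.
  by rewrite addr0 !scale0r addr0.
have abgt0 : 0 < a + b by rewrite lt_neqAle eq_sym ab0 addr_ge0.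
exists ((a + b)^-1 *: (a *: p + b *: p')); split; last first.
  by rewrite scalerA mulfV // scale1r.
move=> v; rewrite dotZl dotDl !dotZl.
have := gp v; have := gp' v => pv p'v.
rewrite -lerBrDl mulrC ler_pdivrMr //; nra.
Qed.

Lemma descent_set_segment_closed : segment_closed D.
Proof.
move=> _ _ t [eta Neta [_ [th [p [[th01 th1] fp ->]]] <-]]
  [eta' Neta' [_ [th' [p' [[th'01 th'1] fp' ->]]] <-]] /andP[t0 t1].
have t1' : 0 <= 1 - t by lra.
have /choice[p'' p''P] (i : 'I_q) : exists p'', subdifferential dot (f i) u p'' /\
    (t * th i + (1 - t) * th' i) *: p'' =
    (t * th i) *: p i + ((1 - t) * th' i) *: p' i.
  have /andP[? _] := th01 i; have /andP[? _] := th'01 i.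
  by apply: subdifferential_mixture; rewrite ?mulr_ge0.
exists (t *: eta + (1 - t) *: eta').
  by apply: normal_coneD; apply: normal_coneZ.
exists (\sum_(i < q) (t * th i + (1 - t) * th' i) *: p'' i).
  exists (fun i => t * th i + (1 - t) * th' i), p''; split=> //; last first.
    by move=> i; exact: (p''P i).1.
  split=> [i|]; last by rewrite big_split /= -!mulr_sumr th1 th'1; lra.
  have /andP[? ?] := th01 i; have /andP[? ?] := th'01 i; nra.
under eq_bigr do rewrite (p''P _).2 -!scalerA.
rewrite big_split /= -!scaler_sumr !scalerBr !scalerN.
by rewrite 2!opprD addrACA.
Qed.

Lemma subdifferential_weak_lim (g : H -> R) (U : set_system nat)
    {UU : ProperFilter U} (p : nat -> H) (l : H) :
    (forall n, subdifferential dot g u (p n)) ->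
    (forall h, dot (p n) h @[n --> U] --> dot l h) ->
  subdifferential dot g u l.
Proof.
move=> gp pl v; rewrite -lerBrDl.
apply: (ler_cvg_to (pl (v - u)) (cvg_cst (g v - g u))).
by apply: nearW => n; rewrite lerBrDl; exact: gp.
Qed.

Lemma cvg_sum_ord (U : set_system nat) {UU : ProperFilter U} (m : nat)
    (F : nat -> 'I_m -> R) (l : 'I_m -> R) :
  (forall i, F n i @[n --> U] --> l i) ->
  \sum_(i < m) F n i @[n --> U] --> \sum_(i < m) l i.
Proof.
by move=> Fl; apply: (cvg_big _ (Ff := fun i n => F n i)) => //; exact: add_continuous.
Qed.

(* Bounded subgradients have weak limits along an ultrafilter refining \oo;
   all the conditions that define the descent set pass to such limits. *)
Lemma descent_set_seq_closed (c : R) :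
    (forall i p, subdifferential dot (f i) u p -> `|p| <= c) ->
  forall (x : nat -> H) l, (forall n, D (x n)) -> x n @[n --> \oo] --> l -> D l.
Proof.
move=> fc x l Dx xl.
have /choice[eta] (n : nat) : exists eta, exists th, exists p : 'I_q -> H,
    [/\ N eta, simplex th, forall i, subdifferential dot (f i) u (p i) &
        x n = - eta - \sum_(i < q) th i *: p i].
  by have [eta Neta [_ [th [p [thS fp ->]]] <-]] := Dx n; exists eta, th, p.
move=> /choice[th] /choice[p] xE.
have [U [UU ooU]] := ultraFilterLemma (_ : ProperFilter \oo).
have thU i : cvg (th n i @[n --> U]).
  apply: (@ultra_bounded_cvg _ _ _ _ 1) => n.
  by have [_ [/(_ i)/andP[? ?] _] _ _] := xE n; rewrite ger0_norm.
have /choice[pl plP] (i : 'I_q) :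
    exists pl, forall h, dot (p n i) h @[n --> U] --> dot pl h.
  apply: (@ultra_bounded_weak_cvg _ _ _ norm_dot _ _ _ c) => n.
  by have [_ _ fp _] := xE n; exact: fc (fp i).
pose thl i := lim (th n i @[n --> U]).
have xlU : x n @[n --> U] --> l by apply: cvg_trans xl; exact: cvg_app.
(* No bound on the normal parts [eta n] is at hand; they converge weakly because the other terms of
   [xE] do, which forces this witness. *)
exists (- l - \sum_(i < q) thl i *: pl i); last first.
  exists (\sum_(i < q) thl i *: pl i); last by rewrite opprB opprK addrAC subrr add0r.
  exists thl, pl; split=> // [|i]; last first.
    by apply: subdifferential_weak_lim (plP i) => n; have [_ _ fp _] := xE n.
  split=> [i|]; last first.
    have th1 : (fun n => \sum_(i < q) th n i) = fun=> 1.
      by apply/funext => n; have [_ [_ ->] _ _] := xE n.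
    have thl1 : \sum_(i < q) th n i @[n --> U] --> \sum_(i < q) thl i.
      exact: cvg_sum_ord thU.
    rewrite th1 in thl1.
    exact: (cvg_unique (@Rhausdorff R) thl1 (cvg_cst (1 : R))).
  apply/andP; split.
    apply: (ler_cvg_to (cvg_cst 0) (thU i)).
    by apply: nearW => n; have [_ [/(_ i)/andP[? ?] _] _ _] := xE n.
  apply: (ler_cvg_to (thU i) (cvg_cst (1 : R))).
  by apply: nearW => n; have [_ [/(_ i)/andP[? ?] _] _ _] := xE n.
move=> v Kv.
have etal : dot (eta n) (v - u) @[n --> U] -->
    dot (- l - \sum_(i < q) thl i *: pl i) (v - u).
  have etaE n : dot (eta n) (v - u) =
      - dot (x n) (v - u) - \sum_(i < q) th n i * dot (p n i) (v - u).
    have [_ _ _ ->] := xE n; rewrite (dotDl dot (- eta n)) !dotNl dot_lincombl.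
    by rewrite opprB opprK addrAC subrr add0r.
  under eq_fun do rewrite etaE.
  rewrite dotDl !dotNl dot_lincombl.
  apply: cvgB; first by apply: cvgN; exact: dot_cvg.
  by apply: cvg_sum_ord => i; apply: cvgM; [exact: thU | exact: plP].
apply: (ler_cvg_to etal (cvg_cst 0)).
by apply: nearW => n; have [Neta _ _ _] := xE n; exact: Neta.
Qed.

End descent_set.

(** * Optimality of the steepest descent direction *)

Section power_inequalities.
Context {R : realType}.
Implicit Types a b r x : R.

Lemma powR_gt_tangent1 r x : 1 < r -> 0 <= x -> x != 1 ->
  1 + r * (x - 1) < x `^ r.
Proof.
move=> r1; rewrite le_eqVlt => /predU1P[<- _|x0 x1].
  by rewrite powR0 ?gt_eqF; lra.
have lnx : ln x != 0 by rewrite ln_eq0.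
have -> : x `^ r = x * expR ((r - 1) * ln x).
  rewrite /powR gt_eqF // -{2}(lnK x0) -expRD; congr expR; ring.
(* Divided by x = exp y, the claim is exp ((r - 1) y) + (r - 1) exp (- y) > r,
   which follows from exp z >= 1 + z at both exponents. *)
have e1 : 1 + (r - 1) * ln x < expR ((r - 1) * ln x).
  by rewrite expR_gt1Dx // mulf_neq0 // subr_eq0 gt_eqF.
have e2 : 1 - ln x <= x^-1.
  by have := expR_ge1Dx (- ln x); rewrite expRN lnK.
have xV : x * x^-1 = 1 by rewrite mulfV // gt_eqF.
have : x * (r - (r - 1) * x^-1) < x * expR ((r - 1) * ln x).
  by rewrite ltr_pM2l //; nra.
have -> : x * (r - (r - 1) * x^-1) = x * r - (r - 1) * (x * x^-1) by ring.
rewrite xV; lra.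
Qed.

Lemma powR_gt_tangent r a b : 1 < r -> 0 <= a -> 0 < b -> a != b ->
  r^-1 * b `^ r - b `^ (r - 1) * b < r^-1 * a `^ r - b `^ (r - 1) * a.
Proof.
move=> r1 a0 b0 ab.
have r0 : 0 < r by lra.
have b1 : b `^ (r - 1) * b = b `^ r.
  rewrite -[X in _ * X](powRr1 (ltW b0)) -powRD ?subrK //.
  by apply/implyP => _; rewrite gt_eqF.
have abE : a = a / b * b by rewrite divfK // gt_eqF.
have ab0 : 0 <= a / b by rewrite divr_ge0 // ltW.
have ab1 : a / b != 1.
  by apply: contra_neq ab => ab1; rewrite abE ab1 mul1r.
rewrite abE powRM // ?(ltW b0) // [b `^ (r - 1) * (_ * b)]mulrCA b1.
have := powR_gt_tangent1 r1 ab0 ab1; have := powR_gt0 r b0.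
move: (a / b) (b `^ r) => x B B0 xr.
have -> : r^-1 * B - B = B * (r^-1 * (1 - r)) by field; rewrite gt_eqF.
have -> : r^-1 * (x `^ r * B) - x * B = B * (r^-1 * (x `^ r - r * x)).
  by field; rewrite gt_eqF.
by rewrite ltr_pM2l // ltr_pM2l ?invr_gt0 //; lra.
Qed.

End power_inequalities.

Section fin_max.
Context {R : realType} (q : nat) (hq : (0 < q)%N).
Implicit Types F : 'I_q -> R.

Lemma le_fin_max F i : F i <= fin_max hq F.
Proof. exact: le_bigmax. Qed.

Lemma fin_max_le F a : (forall i, F i <= a) -> fin_max hq F <= a.
Proof. by move=> Fa; apply: bigmax_le. Qed.

End fin_max.

Lemma lipschitz_at {R : realType} {H : completeNormedModType R}
    (f : H -> R) (u : H) :
    (forall B : set H, bounded_set B -> [lipschitz (f x) | x in B]) ->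
  exists c, 0 <= c /\ forall x, `|x - u| <= 1 -> `|f x - f u| <= c * `|x - u|.
Proof.
move=> flip; have [|c [_ cP]] := flip [set x | `|x - u| <= 1].
  exists (`|u| + 1); split; first exact: num_real.
  move=> M uM x /= xu; have := ler_normD (x - u) u; rewrite subrK; lra.
(* The Lipschitz bound holds for all constants above [c]; this one is also nonnegative. *)
exists (`|c| + 1); split=> [|x xu]; first by rewrite addr_ge0.
have cc : c < `|c| + 1 by have := ler_norm c; lra.
by apply: (cP _ cc (x, u)); split=> //=; rewrite subrr normr0.
Qed.

Section steepest_descent.
Context {R : realType} {H : completeNormedModType R} (dot : {dot H for idfun}).
Context (norm_dot : forall x : H, `|x| ^+ 2 = dot x x).
Context (K : set H) (q : nat) (q_gt0 : (0 < q)%N) (f : 'I_q -> H -> R) (u : H).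
Context (f_convex : forall i, convex_function [set: H] (f i)).
Context (c : R) (c_ge0 : 0 <= c).
Context (f_lip : forall i x, `|x - u| <= 1 -> `|f i x - f i u| <= c * `|x - u|).
Local Notation N := (normal_cone dot K u).
Local Notation T := (tangent_cone dot K u).
Local Notation D := (descent_set dot K f u).
Local Notation maxdf d :=
  (fin_max q_gt0 (fun i => directional_derivative (f i) u d)).

Lemma subdifferential_neq0 i : subdifferential dot (f i) u !=set0.
Proof.
have [p [fp _]] := approx_subgradient norm_dot (f_convex i) c_ge0 (@f_lip i) 0 ltr01.
by exists p.
Qed.

(** The weights are the indicator of [i], but membership still asks for a subgradient at every other
    index, supplied by [subdifferential_neq0]. *)
Lemma conv_subdifferentials_vertex i p :
  subdifferential dot (f i) u p -> conv_subdifferentials dot f u p.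
Proof.
move=> fp; have /choice[p' fp'] := subdifferential_neq0.
exists (fun j => (j == i)%:R), (fun j => if j == i then p else p' j); split.
- split=> [j|]; first by case: eqP; rewrite ?lexx ?ler01.
  by rewrite (bigD1 i) //= eqxx big1 ?addr0 // => j /negPf ->.
- by move=> j; case: eqP => [->|_].
- by rewrite (bigD1 i) //= eqxx scale1r big1 ?addr0 // => j /negPf ->; rewrite scale0r.
Qed.

Lemma descent_set_neq0 : D !=set0.
Proof.
have [p fp] := subdifferential_neq0 (Ordinal q_gt0).
exists (- 0 - p), 0; first exact: normal_cone0.
by exists p => //; exact: conv_subdifferentials_vertex fp.
Qed.

Lemma argmin_descent_set_exists : exists s, argmin D (fun x => `|x|) s.
Proof.
apply: (argmin_norm_exists norm_dot).
- exact: descent_set_neq0.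
- exact: descent_set_segment_closed.
- apply: (@descent_set_seq_closed _ _ _ norm_dot _ _ _ _ c) => i p.
  exact: (subdifferential_norm_le norm_dot (f_convex i) c_ge0 (@f_lip i)).
Qed.

Context (s : H) (s_min : argmin D (fun x => `|x|) s).

Lemma min_norm_subgradient i p :
  subdifferential dot (f i) u p -> dot s p <= - `|s| ^+ 2.
Proof.
move=> fp; have Dp : D (- 0 - p).
  exists 0; first exact: normal_cone0.
  by exists p => //; exact: conv_subdifferentials_vertex fp.
have := argmin_norm_dot norm_dot (@descent_set_segment_closed _ _ _ _ _ _ _) s_min Dp.
by rewrite oppr0 add0r dotNr; lra.
Qed.

Lemma min_norm_tangent : T s.
Proof.
move=> eta Neta; rewrite leNgt; apply/negP => eta0.
have [p fp] := subdifferential_neq0 (Ordinal q_gt0).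
(* With [a * dot s eta = |dot s p| + 1], the variational inequality would give [|s|^2 <= -1]. *)
pose a := (`|dot s p| + 1) / dot s eta.
have a0 : 0 <= a by rewrite divr_ge0 ?(ltW eta0) // addr_ge0.
have Dp : D (- (a *: eta) - p).
  exists (a *: eta); first exact: normal_coneZ.
  by exists p => //; exact: conv_subdifferentials_vertex fp.
have := argmin_norm_dot norm_dot (@descent_set_segment_closed _ _ _ _ _ _ _) s_min Dp.
rewrite dotDr !dotNr dotZr /a divfK ?gt_eqF //.
have := ler_norm (- dot s p); rewrite normrN; have := sqr_ge0 `|s|; lra.
Qed.

(** Each [df_i(u, s)] is approached by pairings of [s] with subgradients, all at most [- |s|^2]. The
    factor [a] serves the two normalizations of [s]. *)
Lemma maxdf_min_norm_le a : 0 < a -> maxdf (a *: s) <= - (a * `|s| ^+ 2).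
Proof.
move=> a0; apply: fin_max_le => i.
rewrite (directional_derivativeZ (f_convex i) u s a0) -mulrN ler_pM2l //.
apply/ler_addgt0Pr => e e0.
have [p [fp ep]] :=
  approx_subgradient norm_dot (f_convex i) c_ge0 (@f_lip i) s e0.
have := min_norm_subgradient fp; rewrite (dotC dot s p); lra.
Qed.

Lemma maxdf_ge d : T d -> - dot s d <= maxdf d.
Proof.
have [[eta Neta [_ [th [p [[th01 th1] fp ->]]] sE]] _] := s_min.
move=> Td; rewrite -sE dotDl !dotNl dot_lincombl opprD !opprK.
have := Td _ Neta; rewrite (dotC dot d eta) => etad.
suff : \sum_i th i * dot (p i) d <= maxdf d by lra.
rewrite -[leRHS]mul1r -th1 mulr_suml; apply: ler_sum => i _.
rewrite ler_wpM2l //; first by have /andP[] := th01 i.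
apply: le_trans (le_fin_max _ _ i).
exact: (subdifferential_le_directional (f_convex i) _ (fp i)).
Qed.

End steepest_descent.

(** Under the hypotheses [|y - k s|^2] expands to a nonpositive quantity. *)
Lemma cauchy_schwarz_eq {R : realType} {H : completeNormedModType R}
    (dot : {dot H for idfun}) (norm_dot : forall x : H, `|x| ^+ 2 = dot x x)
    (s y : H) (k : R) :
  0 <= k -> `|y| = k * `|s| -> `|s| * `|y| <= dot s y -> y = k *: s.
Proof.
move=> k0 yE sy; apply/eqP; rewrite -subr_eq0 -normr_eq0 -sqrf_eq0.
rewrite eq_le sqr_ge0 andbT (normB2 norm_dot) dotZr (dotC dot y s) normrZ.
by rewrite ger0_norm // -yE; move: sy; rewrite yE; nra.
Qed.

(** * Unique minimizers from the two bounds on the objective *)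

Section minimizers.
Context {R : realType} {H : completeNormedModType R} (dot : {dot H for idfun}).
Context (norm_dot : forall x : H, `|x| ^+ 2 = dot x x).
Context (T : set H) (m : H -> R) (s : H).
Context (s_neq0 : s != 0) (Ts : T s).
Context (TZ : forall a d, 0 < a -> T d -> T (a *: d)).
Context (m_ge : forall d, T d -> - dot s d <= m d).
Context (m_le : forall a, 0 < a -> m (a *: s) <= - (a * `|s| ^+ 2)).

Let s_gt0 : 0 < `|s|. Proof. by rewrite normr_gt0. Qed.

(** On the sphere [m d >= - dot s d >= - |s|]. The normalized [s] attains this bound, and equality
    in Cauchy-Schwarz singles it out. *)
Lemma argmin_unit_sphere :
  argmin [set d | T d /\ `|d| = 1] m = [set `|s|^-1 *: s].
Proof.
have sV0 : 0 < `|s|^-1 by rewrite invr_gt0.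
have mv : m (`|s|^-1 *: s) <= - `|s|.
  by have := m_le sV0; rewrite expr2 mulKf ?gt_eqF.
have Tv : T (`|s|^-1 *: s) by exact: TZ.
have v1 : `| `|s|^-1 *: s| = 1 by rewrite normrZ gtr0_norm // mulVf // gt_eqF.
apply/seteqP; split=> [x [[Tx x1] xmin]|_ ->] /=.
  apply: (cauchy_schwarz_eq norm_dot); first exact: ltW.
    by rewrite x1 mulVf // gt_eqF.
  by have := m_ge Tx; have := xmin _ (conj Tv v1); rewrite x1; lra.
split=> // y [Ty y1]; apply: le_trans mv _; apply: le_trans (m_ge Ty).
by have := cauchy_schwarz norm_dot s y; rewrite y1; lra.
Qed.

Lemma argmin_power_penalty r : 1 < r ->
  argmin T (fun d => r^-1 * `|d| `^ r + m d) =
  [set (`|s| `^ ((r - 2) / (r - 1)))^-1 *: s].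
Proof.
move=> r1; set k := (_ `^ _)^-1.
have k0 : 0 < k by rewrite invr_gt0 powR_gt0.
have b0 : 0 < k * `|s| by rewrite mulr_gt0.
have vb : `|k *: s| = k * `|s| by rewrite normrZ gtr0_norm.
(* [k * |s|] is the stationary radius: the tangent slope there is [|s|]. *)
have br : (k * `|s|) `^ (r - 1) = `|s|.
  rewrite /k -powRN -[X in _ * X](powRr1 (ltW s_gt0)) -powRD; last first.
    by apply/implyP => _; rewrite gt_eqF.
  have -> : - ((r - 2) / (r - 1)) + 1 = (r - 1)^-1.
    by field; rewrite gt_eqF // subr_gt0.
  by rewrite -powRrM mulVf ?powRr1 ?(ltW s_gt0) // gt_eqF // subr_gt0.
have mv : m (k *: s) <= - (`|s| * (k * `|s|)) by have := m_le k0; rewrite expr2 mulrCA.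
have Tv : T (k *: s) by exact: TZ.
apply/seteqP; split=> [x [Tx xmin]|_ ->] /=.
  have := xmin _ Tv; rewrite vb => {}xmin.
  have := cauchy_schwarz norm_dot s x; have := m_ge Tx => mx cs.
  have [xb|xb] := eqVneq `|x| (k * `|s|).
    apply: (cauchy_schwarz_eq norm_dot) => //; first exact: ltW.
    by move: xmin; rewrite xb; lra.

  exfalso; have := powR_gt_tangent r1 (normr_ge0 x) b0 xb; rewrite br; lra.
split=> // y Ty; rewrite vb.
have := cauchy_schwarz norm_dot s y; have := m_ge Ty => my cs.
have [yb|yb] := eqVneq `|y| (k * `|s|).
  by move: cs; rewrite yb; lra.

by have := powR_gt_tangent r1 (normr_ge0 y) b0 yb; rewrite br; lra.
Qed.

End minimizers.

Theorem theorem1p9 (R : realType) (H : completeNormedModType R)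
    (dot : {dot H for idfun})
    (norm_dot : forall x : H, `|x| ^+ 2 = dot x x)
    (K : set H) (K_neq0 : K !=set0) (K_closed : closed K)
    (K_convex : convex_set K)
    (q : nat) (q_gt0 : (0 < q)%N) (f : 'I_q -> H -> R)
    (f_convex : forall i, convex_function [set: H] (f i))
    (f_continuous : forall i, continuous (f i))
    (f_lipschitz : forall i (B : set H),
       bounded_set B -> [lipschitz (f i x) | x in B])
    (f_bounded_below : forall i, has_lbound (range (f i)))
    (u : H) (u_in : (K `\` pareto_critical dot K f) u) :
  let s := steepest_descent dot K f u in
  let T := tangent_cone dot K u in
  let maxdf d := fin_max q_gt0 (fun i => directional_derivative (f i) u d) in
  [/\ argmin (descent_set dot K f u) (fun x => `|x|) = [set s],
      forall r : R, 1 < r ->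
        argmin T (fun d => r^-1 * `|d| `^ r + maxdf d) =
        [set (`|s| `^ ((r - 2) / (r - 1)))^-1 *: s]
    & argmin [set d | T d /\ `|d| = 1] maxdf = [set `|s|^-1 *: s]].
Proof.
move=> s T maxdf; have [Ku u_ncrit] := u_in.
have /choice[c' c'P] i := lipschitz_at u (f_lipschitz i).
(* The sum is a common Lipschitz constant for all [f i]. *)
pose c := \sum_i c' i.
have c0 : 0 <= c by apply: sumr_ge0 => i _; exact: (c'P i).1.
have f_lip i x : `|x - u| <= 1 -> `|f i x - f i u| <= c * `|x - u|.
  move=> xu; apply: le_trans ((c'P i).2 x xu) _; rewrite ler_wpM2r //.
  rewrite /c (bigD1 i) //= lerDl; apply: sumr_ge0 => j _; exact: (c'P j).1.
have [s' s'min] := argmin_descent_set_exists norm_dot K q_gt0 f_convex c0 f_lip.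
(* A minimizer exists, so [xget] does not return its default [0]. *)
have smin : argmin (descent_set dot K f u) (fun x => `|x|) s.
  by apply: xgetPex; exists s'.
(* If [s = 0], its decomposition in the descent set is a certificate of Pareto criticality. *)
have s_neq0 : s != 0.
  apply/eqP => s0; apply: u_ncrit; split=> //.
  have [[eta Neta [_ [th [p [thS fp ->]]] etaE]] _] := smin.
  exists th => //; exists eta, p; split=> //.
  by apply/eqP; rewrite eq_sym -oppr_eq0 opprD etaE s0.
have Ts : T s := min_norm_tangent norm_dot q_gt0 f_convex c0 f_lip smin.
have TZ a d : 0 < a -> T d -> T (a *: d).
  by move=> a0 Td eta Neta; rewrite dotZl mulr_ge0_le0 ?(ltW a0) // Td.
have m_ge := maxdf_ge q_gt0 f_convex smin.
have m_le := maxdf_min_norm_le norm_dot q_gt0 f_convex c0 f_lip smin.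
split.
- apply/seteqP; split=> [x xmin|_ ->//] /=.
  exact: (argmin_norm_uniq norm_dot (@descent_set_segment_closed _ _ _ _ _ _ _) xmin smin).
- exact: (argmin_power_penalty norm_dot s_neq0 Ts TZ m_ge m_le).
- exact: (argmin_unit_sphere norm_dot s_neq0 Ts TZ m_ge m_le).
Qed.
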